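(* Let $K(a_{n,k})$ and $K(b_{n,k})$ be Köthe spaces and let $\theta=(\theta_n)_{n\in\mathbb{N}_0}$ be a sequence of scalars. The Rhaly operator $R_\theta:K(a_{n,k})\to K(b_{n,k})$ is well-defined and continuous if and only if $\theta\in K(b_{n,k})$ and the following condition holds: for every $k\in\mathbb{N}$ there exists $m\in\mathbb{N}$ such that $$\sup_{n\in\mathbb{N}}\frac{\|R_\theta e_n\|_k}{\|e_n\|_m}<\infty .$$
   Context: $\mathbb{N}=\{1,2,\dots\}$, $\mathbb{N}_0=\{0,1,2,\dots\}$. A Köthe matrix is a matrix $(a_{n,k})_{n,k\in\mathbb{N}}$ of non-negative numbers such that for each $n$ there is $k$ with $a_{n,k}>0$, and $a_{n,k}\le a_{n,k+1}$ for all $n,k$. The Köthe space is $K(a_{n,k})=\{x=(x_n)_{n\in\mathbb{N}}:\|x\|_k:=\sum_{n=1}^\infty |x_n|a_{n,k}<\infty\ \text{for all }k\in\mathbb{N}\}$, a Fréchet space with the seminorms $\|\cdot\|_k$. $e_n$ is the sequence with $1$ in the $n$-th place and $0$ elsewhere; in the displayed condition $\|R_\theta e_n\|_k$ is the $k$-th seminorm of $K(b_{n,k})$ and $\|e_n\|_m=a_{n,m}$ is the $m$-th seminorm of $K(a_{n,k})$. The condition that the supremum is finite is understood as: there is $C>0$ with $\|R_\theta e_n\|_k\le C\|e_n\|_m$ for all $n\in\mathbb{N}$. A sequence $\theta=(\theta_n)_{n\in\mathbb{N}_0}$ is viewed as an element of a sequence space indexed by $\mathbb{N}$ by taking $\theta_{n-1}$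 as its $n$-th coordinate (so in $K(b_{n,k})$, $\|\theta\|_k=\sum_{n=1}^\infty|\theta_{n-1}|b_{n,k}$). The Rhaly operator $R_\theta$ is defined by $R_\theta e_n=\sum_{j=n}^\infty \theta_{j-1}e_j$ and $R_\theta x=\sum_{n=1}^\infty x_nR_\theta e_n=\sum_{n=1}^\infty\big(\sum_{j=1}^n x_j\big)\theta_{n-1}e_n$ for $x=\sum_n x_ne_n\in K(a_{n,k})$. It is well-defined if $R_\theta e_n\in K(b_{n,k})$ for all $n$ and the series $\sum_n x_nR_\theta e_n$ converges in $K(b_{n,k})$ for every $x\in K(a_{n,k})$. *)

(* Defs.v *)
From HB Require Import structures.
From mathcomp Require Import all_boot all_order all_algebra complex.
From mathcomp Require Import all_classical all_reals ereal topology normedtype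
  sequences.

Set Implicit Arguments.
Unset Strict Implicit.
Unset Printing Implicit Defensive.

Import Order.TTheory GRing.Theory Num.Theory.
Import numFieldNormedType.Exports.

Local Open Scope classical_set_scope.
Local Open Scope ring_scope.

(** Scalars are real or complex.  The norm of [R[i]] takes its values in
    [R[i]]; [modulus] is the corresponding [R]-valued absolute value. *)
Variant scalar_kind := RealScalars | ComplexScalars.

Definition scalar_field (R : realType) (s : scalar_kind) : numFieldType :=
  match s with
  | RealScalars => R
  | ComplexScalars => R[i]
  end.

Definition modulus (R : realType) (s : scalar_kind) : scalar_field R s -> R :=
  match s with
  | RealScalars => fun x : R => `|x|
  | ComplexScalars => fun z : R[i] => complex.Re `|z|
  end.

Section Modulus.
Context (R : realType) (s : scalar_kind).
Implicit Types x y : scalar_field R s.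

Let normcE (z : R[i]) : ((complex.Re `|z|)%:C)%C = `|z|.
Proof. by rewrite normc_def. Qed.

Lemma modulus0 : modulus (0 : scalar_field R s) = 0.
Proof.
case: s => /=; first exact: (@normr0 _ R).
exact: (congr1 (@complex.Re R) (@normr0 _ R[i])).
Qed.

Lemma modulus1 : modulus (1 : scalar_field R s) = 1.
Proof.
case: s => /=; first exact: (@normr1 R).
exact: (congr1 (@complex.Re R) (@normr1 R[i])).
Qed.

Lemma modulus_ge0 x : 0 <= modulus x.
Proof.
case: s x => /= x; first exact: normr_ge0.
by rewrite -lecR normcE normr_ge0.
Qed.

Lemma modulus_eq0 x : modulus x = 0 -> x = 0.
Proof.
case: s x => /= x; first by move/eqP; rewrite normr_eq0 => /eqP.
move=> x0; apply/eqP; rewrite -(@normr_eq0 _ R[i]) -normcE; apply/eqP.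
exact: (congr1 (@real_complex R) x0).
Qed.

Lemma modulusM x y : modulus (x * y) = modulus x * modulus y.
Proof.
case: s x y => /= x y; first exact: normrM.
by apply: (@complexI R); rewrite rmorphM /= !normcE; exact: (@normrM R[i]).
Qed.

Lemma modulusD x y : modulus (x + y) <= modulus x + modulus y.
Proof.
case: s x y => /= x y; first exact: ler_normD.
by rewrite -lecR rmorphD /= !normcE; exact: (@ler_normD _ R[i]).
Qed.

Lemma modulusN x : modulus (- x) = modulus x.
Proof.
case: s x => /= x; first exact: (@normrN _ R).
exact: (congr1 (@complex.Re R) (@normrN _ R[i] x)).
Qed.

End Modulus.

Record koethe_matrix (R : realType) := KoetheMatrix {
  koethe_entry :> nat -> nat -> R ;
  koethe_ge0 : forall n k, 0 <= koethe_entry n k ;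
  koethe_gt0 : forall n, exists k, 0 < koethe_entry n k ;
  koethe_le : forall n k, koethe_entry n k <= koethe_entry n k.+1
}.

(** All indices (coordinates [n] and seminorms [k]) start at 0: the [n]-th
    coordinate here is the [n+1]-st one of a sequence indexed by 1, 2, ...
    In particular a sequence [theta_0, theta_1, ...] has [theta n] as its
    [n]-th coordinate. *)
Section KoetheSpace.
Context (R : realType) (s : scalar_kind) (a : koethe_matrix R).
Local Notation K := (scalar_field R s).
Implicit Types (x y : nat -> K^o) (k : nat).

Definition koethe_seminorm k x : \bar R :=
  (\sum_(n <oo) (modulus (x n) * a n k)%:E)%E.

Definition in_koethe : {pred nat -> K^o} :=
  fun x => `[< forall k, (koethe_seminorm k x < +oo)%E >].

Lemma koethe_term_ge0 k x n : (0 <= (modulus (x n) * a n k)%:E)%E.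
Proof. by rewrite lee_fin mulr_ge0 ?modulus_ge0 ?koethe_ge0. Qed.

Lemma koethe_seminorm_ge0 k x : (0 <= koethe_seminorm k x)%E.
Proof. by apply: nneseries_ge0 => n _ _; exact: koethe_term_ge0. Qed.

Lemma koethe_term_le k x n :
  ((modulus (x n) * a n k)%:E <= koethe_seminorm k x)%E.
Proof.
rewrite /koethe_seminorm (@nneseriesD1 _ _ n)//; last first.
  by move=> i _; exact: koethe_term_ge0.
by rewrite leeDl// nneseries_ge0// => i _ _; exact: koethe_term_ge0.
Qed.

Lemma koethe_seminorm0 k : koethe_seminorm k 0 = 0%E.
Proof. by apply: eseries0 => n _ _; rewrite /= modulus0 mul0r. Qed.

Lemma koethe_seminormD k x y :
  (koethe_seminorm k (x + y)%R <= koethe_seminorm k x + koethe_seminorm k y)%E.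
Proof.
rewrite /koethe_seminorm -nneseriesD => [| |n _ _]; last exact: koethe_term_ge0.
  apply: lee_nneseries => n _; first by move=> _; exact: koethe_term_ge0.
  by rewrite -EFinD lee_fin -mulrDl ler_wpM2r ?koethe_ge0 ?modulusD.
by move=> n _ _; exact: koethe_term_ge0.
Qed.

Lemma koethe_seminormZ k (c : K) x :
  koethe_seminorm k (c *: x) =
  ((modulus c)%:E * koethe_seminorm k x)%E.
Proof.
rewrite /koethe_seminorm -nneseriesZl; last first.
  by move=> n _; exact: koethe_term_ge0.
by apply: eq_eseriesr => n _; rewrite -EFinM mulrA -modulusM.
Qed.

Lemma koethe_seminormN k x : koethe_seminorm k (- x) = koethe_seminorm k x.
Proof. by apply: eq_eseriesr => n _; rewrite -[in RHS]modulusN. Qed.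

Lemma koethe_seminorm_le k l x : (k <= l)%N ->
  (koethe_seminorm k x <= koethe_seminorm l x)%E.
Proof.
move=> kl; apply: lee_nneseries => n _; first by move=> _; exact: koethe_term_ge0.
rewrite lee_fin ler_wpM2l ?modulus_ge0//.
by apply: (homo_leq (@lexx _ R) (@le_trans _ R)) kl => i; exact: koethe_le.
Qed.

Lemma in_koethe_submod_closed : submod_closed in_koethe.
Proof.
split=> [|c x y /asboolP xa /asboolP ya]; apply/asboolP => k.
  by rewrite koethe_seminorm0 ltry.
apply: le_lt_trans (koethe_seminormD _ _ _) _.
by rewrite koethe_seminormZ lte_add_pinfty// lte_mul_pinfty// lee_fin modulus_ge0.
Qed.

HB.instance Definition _ :=
  GRing.isSubmodClosed.Build K (nat -> K^o) in_koethe in_koethe_submod_closed.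

Record koethe_space := KoetheSpace {
  koethe_seq :> nat -> K^o ;
  koethe_seqP : koethe_seq \in in_koethe
}.

HB.instance Definition _ := [isSub for koethe_seq].
HB.instance Definition _ := [Choice of koethe_space by <:].
HB.instance Definition _ := [SubChoice_isSubLmodule of koethe_space by <:].
HB.instance Definition _ := isPointed.Build koethe_space 0.

(** The topology of the seminorms.  As they increase with [k], the balls of
    the single seminorms already form a base of neighbourhoods. *)
Definition koethe_ball (x : koethe_space) k (e : R) : set koethe_space :=
  [set y : koethe_space | (koethe_seminorm k (koethe_seq (y - x)%R) < e%:E)%E].

Definition koethe_nbhs (x : koethe_space) : set_system koethe_space :=
  filter_from [set ke : nat * R | 0 < ke.2] (fun ke => koethe_ball x ke.1 ke.2).

HB.instance Definition _ := hasNbhs.Build koethe_space koethe_nbhs.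

Lemma koethe_ball_center (x : koethe_space) k (e : R) :
  0 < e -> koethe_ball x k e x.
Proof. by move=> e0; rewrite /koethe_ball /= subrr koethe_seminorm0 lte_fin. Qed.

Let koethe_nbhs_filter (x : koethe_space) : ProperFilter (nbhs x).
Proof.
apply: filter_from_proper; last first.
  by move=> [k e] /= e0; exists x; exact: koethe_ball_center.
apply: filter_from_filter; first by exists (0%N, 1) => /=.
move=> [k e] [l f] /= e0 f0; exists (maxn k l, Num.min e f) => /=.
  by rewrite lt_min e0.
move=> y; rewrite /koethe_ball /= => yx; split.
  apply: le_lt_trans (koethe_seminorm_le _ (leq_maxl k l)) (lt_le_trans yx _).
  by rewrite lee_fin ge_min lexx.
apply: le_lt_trans (koethe_seminorm_le _ (leq_maxr k l)) (lt_le_trans yx _).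
by rewrite lee_fin ge_min lexx orbT.
Qed.

Let koethe_nbhs_singleton (x : koethe_space) (A : set koethe_space) :
  nbhs x A -> A x.
Proof. by move=> [[k e] /= e0]; apply; exact: koethe_ball_center. Qed.

Let koethe_nbhs_nbhs (x : koethe_space) (A : set koethe_space) :
  nbhs x A -> nbhs x (nbhs^~ A).
Proof.
move=> [[k e] /= e0 eA]; exists (k, e / 2) => /=; first by rewrite divr_gt0.
move=> y yx; exists (k, e / 2) => /=; first by rewrite divr_gt0.
move=> z zy; apply: eA.
change (koethe_seminorm k (koethe_seq (z - x)%R) < e%:E)%E.
have -> : z - x = (z - y) + (y - x) by rewrite addrA subrK.
apply: le_lt_trans (koethe_seminormD _ _ _) _.
by rewrite [e]splitr EFinD lteD.
Qed.

HB.instance Definition _ := Nbhs_isNbhsTopological.Build koethe_space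
  koethe_nbhs_filter koethe_nbhs_singleton koethe_nbhs_nbhs.

Lemma koethe_hausdorff : hausdorff_space koethe_space.
Proof.
move=> x y xy; apply/val_inj/funext => n; apply/eqP; rewrite -subr_eq0.
apply/eqP; apply: modulus_eq0; apply/eqP; rewrite eq_le modulus_ge0 andbT.
apply/ler_addgt0Pl => e e0; rewrite addr0.
have [k ank] := koethe_gt0 a n.
set d := e * a n k / 2; have d0 : 0 < d by rewrite divr_gt0// mulr_gt0.
have [z [xz yz]] : koethe_ball x k d `&` koethe_ball y k d !=set0.
  by apply: xy; exists (k, d).
rewrite -(ler_pM2r ank) -lee_fin.
apply: le_trans (koethe_term_le k (koethe_seq (x - y)) n) _.
have -> : x - y = (z - y) - (z - x) by rewrite opprB [RHS]addrC addrA subrK.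
apply: le_trans (koethe_seminormD _ _ _) _.
rewrite koethe_seminormN [e * _]splitr EFinD.
by apply: leeD; exact: ltW.
Qed.

End KoetheSpace.

Section Rhaly.
Context (R : realType) (s : scalar_kind) (a b : koethe_matrix R).
Local Notation K := (scalar_field R s).
Implicit Types (theta : nat -> K) (x : koethe_space s a).

Definition unit_seq (n : nat) : nat -> K^o := fun j => (j == n)%:R.

(** [rhaly_seq theta n] is R_theta e_n as a scalar sequence, and
    [rhaly_unit theta n] the same as an element of K(b); the latter is
    meaningful only when that sequence belongs to K(b) (it is 0 otherwise),
    which [rhaly_well_defined] requires. *)
Definition rhaly_seq theta (n : nat) : nat -> K^o :=
  fun j => if (n <= j)%N then theta j else 0.

Definition rhaly_unit theta (n : nat) : koethe_space s b :=
  insubd (0 : koethe_space s b) (rhaly_seq theta n).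

Definition rhaly_series theta x : nat -> koethe_space s b :=
  series (fun n => (x n : K) *: rhaly_unit theta n).

Definition rhaly_well_defined theta : Prop :=
  (forall n, rhaly_seq theta n \in in_koethe b) /\
  (forall x, cvgn (rhaly_series theta x)).

(** The limit is taken in K(b), where it is unique by [koethe_hausdorff]. *)
Definition rhaly theta x : koethe_space s b := limn (rhaly_series theta x).

Lemma koethe_seminorm_unit_seq k n :
  koethe_seminorm a k (unit_seq n) = (a n k)%:E.
Proof.
rewrite /koethe_seminorm (@nneseriesD1 _ _ n)//; last first.
  by move=> i _; exact: koethe_term_ge0.
rewrite /unit_seq eqxx modulus1 mul1r eseries0 ?adde0// => i _ /= /negbTE ->.
by rewrite modulus0 mul0r.
Qed.

Lemma rhalyE theta x j : rhaly_well_defined theta ->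
  rhaly theta x j = (\sum_(i < j.+1) (x i : K)) * theta j.
Proof.
move=> [memR cvgR]; set c := RHS.
have rhaly_unitE n : koethe_seq (rhaly_unit theta n) = rhaly_seq theta n.
  by rewrite -[LHS]/(val _) insubdK.
have partialE N : (j < N)%N -> rhaly_series theta x N j = c.
  move=> jN; have -> : rhaly_series theta x N j =
      \sum_(0 <= n < N) (x n : K) * rhaly_seq theta n j.
    rewrite /rhaly_series /series /=.
    elim: N {jN} => [|N IHN]; first by rewrite !big_geq.
    by rewrite !big_nat_recr//= -IHN -rhaly_unitE.
  rewrite (big_cat_nat _ jN)//= [X in _ + X]big_nat_cond [X in _ + X]big1.
    rewrite addr0 /c mulr_suml big_mkord; apply: eq_bigr => i _.
    by rewrite /rhaly_seq -ltnS ltn_ord.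
  by move=> n; rewrite andbT => /andP[jn _]; rewrite /rhaly_seq leqNgt jn mulr0.
have [k bjk] := koethe_gt0 b j.
apply/eqP; rewrite -subr_eq0 -oppr_eq0 opprB.
apply/eqP; apply: modulus_eq0; apply/eqP; rewrite eq_le modulus_ge0 andbT.
apply/ler_addgt0Pl => e e0; rewrite addr0.
have /(cvgR x) [N _ ballN] : nbhs (rhaly theta x)
    (koethe_ball (rhaly theta x) k (e * b j k)).
  by exists (k, e * b j k) => //=; rewrite mulr_gt0.
have := ballN (maxn N j.+1) (leq_maxl _ _).
move=> /(le_lt_trans (koethe_term_le _ _ _ j)).
rewrite lte_fin ltr_pM2r// => /ltW.
by rewrite -(partialE (maxn N j.+1))// leq_maxr.
Qed.

End Rhaly.

Arguments rhaly_well_defined {R s} a b theta.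
Arguments rhaly {R s} a b theta x.
Arguments unit_seq {R s} n.

(* Main.v *)
Require Import Defs.
From HB Require Import structures.
From mathcomp Require Import all_boot all_order all_algebra complex.
From mathcomp Require Import all_classical all_reals ereal topology normedtype
  sequences.
From mathcomp Require Import esum.

Import Order.TTheory GRing.Theory Num.Theory.

Local Open Scope classical_set_scope.
Local Open Scope ring_scope.

(** Sufficiency: Tonelli gives
    [||R x||_k <= \sum_n |x_n| ||R e_n||_k <= C ||x||_m] for the coordinatewise
    formula of [R].  Applied to the tails of [x], this makes the partial sums of
    [\sum_n x_n R e_n] converge to the coordinatewise candidate, so completeness
    of [K(b)] is never used; applied to differences it gives continuity.
    Necessity: [theta = R e_0], and continuity at [0], tested on multiples of
    the [e_n], gives the estimate. *)

(** Supplies, for both scalar fields at once, the factor by which [e_n] is scaled in the necessity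
    direction. *)
Lemma modulus_surj (R : realType) (s : scalar_kind) (c : R) :
  0 <= c -> exists z : scalar_field R s, modulus z = c.
Proof.
move=> c0; case: s; first by exists c; rewrite /= ger0_norm.
exists (c%:C)%C; rewrite /modulus ger0_norm//.
by rewrite -[0]/((0 : R)%:C)%C lecR.
Qed.

Section CoordinatewiseRhaly.
Context {R : realType} {s : scalar_kind}.
Local Notation K := (scalar_field R s).
Implicit Types (a b : koethe_matrix R) (theta x y : nat -> K^o).

Lemma modulus_sum (N : nat) x :
  modulus (\sum_(0 <= i < N) x i : K) <= \sum_(0 <= i < N) modulus (x i).
Proof.
elim: N => [|N IHN]; first by rewrite !big_geq// modulus0.
rewrite !big_nat_recr//=; apply: le_trans (modulusD _ _) _.
by rewrite lerD2r.
Qed.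

(** Holds by conversion: the difference in the Köthe space becomes one of plain sequences, to which
    [rhaly_mapB] applies. *)
Lemma koethe_ballE a (x y : koethe_space s a) k (e : R) :
  koethe_ball x k e y =
  (koethe_seminorm a k (koethe_seq y - koethe_seq x)%R < e%:E)%E :> Prop.
Proof. by []. Qed.

(** Taking arbitrary sequences as arguments, the formula can be estimated before well-definedness is
    known. *)
Definition rhaly_map theta x : nat -> K^o :=
  fun j => (\sum_(0 <= i < j.+1) (x i : K)) * (theta j : K).

Lemma rhaly_mapB theta x y :
  rhaly_map theta (x - y) = rhaly_map theta x - rhaly_map theta y.
Proof.
apply/funext => j; rewrite /rhaly_map.
have -> : (rhaly_map theta x - rhaly_map theta y) j =
  rhaly_map theta x j - rhaly_map theta y j by [].
by rewrite /rhaly_map -[RHS]mulrBl -sumrB.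
Qed.

Lemma rhaly_map_unit_seq theta (c : K) n :
  rhaly_map theta (c *: (unit_seq n : nat -> K^o)) = c *: rhaly_seq theta n.
Proof.
apply/funext => j.
have -> : (c *: rhaly_seq theta n) j = c * rhaly_seq theta n j by [].
rewrite /rhaly_map /rhaly_seq.
have E i : (c *: (unit_seq n : nat -> K^o)) i = c * (i == n)%:R by [].
under eq_bigr do rewrite E.
rewrite -mulr_sumr -mulrA; congr (_ * _).
case: leqP => nj.
  rewrite (bigD1_seq n) ?mem_index_iota ?iota_uniq//= eqxx big1 ?addr0 ?mul1r//.
  by move=> i /negbTE ->.
rewrite big_nat big1 ?mul0r// => i /= ij.
by rewrite ltn_eqF// (leq_trans ij).
Qed.

Lemma in_koethe_rhaly_seq b theta n :
  theta \in in_koethe b -> rhaly_seq theta n \in in_koethe b.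
Proof.
move=> /asboolP thetab; apply/asboolP => k; apply: le_lt_trans (thetab k).
apply: lee_nneseries => j _; first by move=> _; exact: koethe_term_ge0.
rewrite lee_fin ler_wpM2r ?koethe_ge0// /rhaly_seq.
by case: ifP => // _; rewrite modulus0 modulus_ge0.
Qed.

Lemma koethe_seminorm_rhaly_map b theta k x :
  (koethe_seminorm b k (rhaly_map theta x) <=
   \sum_(n <oo) (modulus (x n))%:E * koethe_seminorm b k (rhaly_seq theta n))%E.
Proof.
(* [t n j] bounds the contribution of [x n] to the [j]-th term of the seminorm; it vanishes for
   [j < n]. *)
pose t n j := (modulus (x n) * (modulus (rhaly_seq theta n j) * b j k))%R.
have t_ge0 n j : 0 <= t n j by rewrite !mulr_ge0 ?modulus_ge0 ?koethe_ge0.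
have -> : (\sum_(n <oo) (modulus (x n))%:E *
    koethe_seminorm b k (rhaly_seq theta n) =
    \sum_(n <oo) \sum_(j <oo) (t n j)%:E)%E.
  apply: eq_eseriesr => n _; rewrite /koethe_seminorm -nneseriesZl//.
  by move=> j _; exact: koethe_term_ge0.
rewrite nneseries_interchange; last by move=> n j; rewrite lee_fin.
apply: lee_nneseries => j _; first by move=> _; exact: koethe_term_ge0.
(* Coordinate [j] involves only [x 0], ..., [x j], so the first [j.+1] terms of the series in [n]
   suffice. *)
apply: le_trans (nneseries_lim_ge j.+1 _); last by move=> n _ _; rewrite lee_fin.
rewrite sumEFin lee_fin /rhaly_map modulusM -mulrA.
apply: le_trans (ler_wpM2r _ (modulus_sum _ _)) _.
  by rewrite mulr_ge0 ?modulus_ge0 ?koethe_ge0.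
rewrite mulr_suml big_nat [leRHS]big_nat ler_sum// => i /= ij.
by rewrite /t /rhaly_seq -ltnS ij.
Qed.

(** Stated in the extended reals for arbitrary [x], so that it serves for membership of [R x] in
    K(b) as well as for tails and differences. *)
Lemma koethe_seminorm_rhaly_map_le a b theta k m (C : R) x :
  (forall n, (koethe_seminorm b k (rhaly_seq theta n) <=
    C%:E * koethe_seminorm a m (@unit_seq R s n))%E) ->
  (koethe_seminorm b k (rhaly_map theta x) <= C%:E * koethe_seminorm a m x)%E.
Proof.
move=> RC; apply: le_trans (koethe_seminorm_rhaly_map _ _ _ _) _.
rewrite /koethe_seminorm -nneseriesZl => [|n _]; last exact: koethe_term_ge0.
apply: lee_nneseries => n _.
  by move=> _; rewrite mule_ge0 ?lee_fin ?modulus_ge0 ?koethe_seminorm_ge0.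
rewrite EFinM muleCA lee_wpmul2l ?lee_fin ?modulus_ge0//.
by apply: le_trans (RC n) _; rewrite koethe_seminorm_unit_seq.
Qed.

Definition seq_tail (N : nat) x : nat -> K^o :=
  fun n => if (N <= n)%N then x n else 0.

Lemma cvg_koethe_seminorm_seq_tail a k x :
  (koethe_seminorm a k x < +oo)%E ->
  koethe_seminorm a k (seq_tail N x) @[N --> \oo] --> 0%E.
Proof.
move=> xk.
have := @nneseries_tail_cvg _ (fun n => (modulus (x n) * a n k)%:E) xpredT xk.
move=> /(_ (fun n _ => koethe_term_ge0 a k x n)).
apply: cvg_trans; apply: near_eq_cvg; apply: nearW => N.
(* The series started at [N] becomes a full series whose terms below [N] are 0, as in [seq_tail]. *)
rewrite eseries_cond eseries_mkcond; apply: eq_eseriesr => n _ /=.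
by rewrite /seq_tail; case: ifP => // _; rewrite modulus0 mul0r.
Qed.

(** By linearity the partial sum is the image of the truncation of [x]; writing the latter as [x]
    minus a tail exposes the error term. *)
Lemma rhaly_seriesE a b theta (x : koethe_space s a) (N : nat) :
  (forall n, rhaly_seq theta n \in in_koethe b) ->
  koethe_seq (rhaly_series b theta x N) =
  rhaly_map theta (koethe_seq x - seq_tail N x).
Proof.
move=> Rb; apply/funext => j; rewrite /rhaly_map.
have -> : koethe_seq (rhaly_series b theta x N) j =
    \sum_(0 <= n < N) (x n : K) * rhaly_seq theta n j.
  rewrite /rhaly_series /series /=; elim: N => [|N IHN]; first by rewrite !big_geq.
  rewrite !big_nat_recr//= -IHN.
  by rewrite -[rhaly_seq theta N](insubdK (0 : koethe_space s b) (Rb N)).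
have E n : (koethe_seq x - seq_tail N x) n = if (n < N)%N then x n else 0.
  rewrite -[LHS]/(koethe_seq x n - seq_tail N x n) /seq_tail ltnNge.
  by case: leqP => _ /=; rewrite ?subrr ?subr0.
under [in RHS]eq_bigr do rewrite E.
rewrite mulr_suml.
(* Two cutoffs meet: [n < N] from the truncation and [n <= j] from the support of [R e_n]. Both sums
   are widened to a common range. *)
have -> : \sum_(0 <= n < N) (x n : K) * rhaly_seq theta n j =
    \sum_(0 <= n < maxn N j.+1 | (n < N)%N && (n < j.+1)%N) (x n : K) * theta j.
  rewrite (big_nat_widen _ _ _ _ _ (leq_maxl N j.+1)) /=.
  rewrite [RHS]big_mkcondr /=; apply: eq_bigr => n _.
  by rewrite /rhaly_seq ltnS; case: ifP => // _; rewrite mulr0.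
rewrite (big_nat_widen _ _ _ _ _ (leq_maxr N j.+1)) /= big_mkcondl /=.
by apply: eq_bigr => n _; case: ifP => // _; rewrite mul0r.
Qed.

Lemma koethe_seq_rhaly {a b theta} : rhaly_well_defined a b theta ->
  forall x : koethe_space s a,
    koethe_seq (rhaly a b theta x) = rhaly_map theta x.
Proof.
by move=> wd x; apply/funext => j; rewrite rhalyE// /rhaly_map big_mkord.
Qed.

End CoordinatewiseRhaly.

Section Boundedness.
Context {R : realType} {s : scalar_kind} {a b : koethe_matrix R}.
Context {theta : nat -> scalar_field R s}.

Lemma rhaly_bounded_of_continuous :
  rhaly_well_defined a b theta -> continuous (rhaly a b theta) ->
  forall k : nat, exists m : nat, exists2 C : R, 0 < C &
    forall n : nat, (koethe_seminorm b k (rhaly_seq theta n) <=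
      C%:E * koethe_seminorm a m (@unit_seq R s n))%E.
Proof.
move=> wd cR k.
have /(cR 0) [[m e] /= e0 eR] : nbhs (rhaly a b theta 0)
  (koethe_ball (rhaly a b theta 0) k 1) by exists (k, 1) => /=.
exists m, (2 / e); first by rewrite divr_gt0.
move=> n; rewrite koethe_seminorm_unit_seq -EFinM.
(* [d] keeps the scaling factor finite when [||e_n||_m = 0]. *)
apply/lee_addgt0Pr => d d0; rewrite -EFinD.
set q := 2 / e * a n m + d.
have q0 : 0 < q by rewrite ltr_wpDl// mulr_ge0 ?koethe_ge0// divr_ge0// ltW.
have qa : q^-1 * a n m < e.
  rewrite ltr_pdivrMl// mulrDl -[ltLHS]addr0 ler_ltD ?mulr_gt0//.
  by rewrite mulrAC divfK ?gt_eqF// ler_peMl ?koethe_ge0// ler1n.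
(* With this [z], the vector [z e_n] lies in the ball of radius [e], so [R (z e_n)] has seminorm
   below 1, that is, [R e_n] has seminorm below [q]. *)
have [|z zc] := modulus_surj R s q^-1; first by rewrite invr_ge0 ltW.
have zeP : z *: (unit_seq n : nat -> (scalar_field R s)^o) \in in_koethe a.
  apply/asboolP => l; rewrite koethe_seminormZ koethe_seminorm_unit_seq.
  by rewrite -EFinM ltry.
pose ze := KoetheSpace zeP.
have : koethe_ball (0 : koethe_space s a) m e ze.
  rewrite koethe_ballE subr0 koethe_seminormZ koethe_seminorm_unit_seq zc.
  by rewrite -EFinM lte_fin.
move=> /eR /=; rewrite koethe_ballE => /ltW.
rewrite !koethe_seq_rhaly// -rhaly_mapB subr0 rhaly_map_unit_seq.
rewrite koethe_seminormZ zc.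
by rewrite lee_pdivrMl// mule1.
Qed.

Lemma rhaly_well_defined_of_bounded :
  theta \in in_koethe b ->
  (forall k : nat, exists m : nat, exists2 C : R, 0 < C &
    forall n : nat, (koethe_seminorm b k (rhaly_seq theta n) <=
      C%:E * koethe_seminorm a m (@unit_seq R s n))%E) ->
  rhaly_well_defined a b theta.
Proof.
move=> thetab bnd; have Rb n := in_koethe_rhaly_seq b theta n thetab.
split=> // x.
have yP : rhaly_map theta x \in in_koethe b.
  apply/asboolP => k; have [m [C C0 RC]] := bnd k.
  apply: le_lt_trans (koethe_seminorm_rhaly_map_le _ _ _ _ _ _ _ RC) _.
  rewrite lte_mul_pinfty ?lee_fin ?(ltW C0)//.
  by have /asboolP := koethe_seqP x.
apply/cvg_ex; exists (KoetheSpace yP) => A [[k e] /= e0 eA].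
have [m [C C0 RC]] := bnd k.
have xm : (koethe_seminorm a m x < +oo)%E by have /asboolP := koethe_seqP x.
have := cvg_koethe_seminorm_seq_tail a m x xm.
(* The threshold [e / C] absorbs the constant [C] of the estimate. *)
move=> /(_ [set r | (r < (e / C)%:E)%E]) [].
  by apply: open_ereal_lt'; rewrite lte_fin divr_gt0.
move=> N _ tailN; exists N => // n /= Nn; apply: eA.
(* The partial sum minus the candidate limit is minus the image of the tail. *)
rewrite koethe_ballE rhaly_seriesE// rhaly_mapB addrAC subrr sub0r.
rewrite koethe_seminormN.
apply: le_lt_trans (koethe_seminorm_rhaly_map_le _ _ _ _ _ _ _ RC) _.
rewrite muleC -lte_pdivlMr//.
exact: (tailN n Nn).
Qed.

Lemma rhaly_continuous_of_bounded :
  rhaly_well_defined a b theta ->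
  (forall k : nat, exists m : nat, exists2 C : R, 0 < C &
    forall n : nat, (koethe_seminorm b k (rhaly_seq theta n) <=
      C%:E * koethe_seminorm a m (@unit_seq R s n))%E) ->
  continuous (rhaly a b theta).
Proof.
move=> wd bnd x A [[k e] /= e0 eA]; have [m [C C0 RC]] := bnd k.
exists (m, e / C) => /=; first by rewrite divr_gt0.
move=> y yx; apply: eA; rewrite /= koethe_ballE !koethe_seq_rhaly// -rhaly_mapB.
apply: le_lt_trans (koethe_seminorm_rhaly_map_le _ _ _ _ _ _ _ RC) _.
by rewrite muleC -lte_pdivlMr.
Qed.

End Boundedness.

Theorem proposition3p1 (R : realType) (s : scalar_kind)
    (a b : koethe_matrix R) (theta : nat -> scalar_field R s) :
  (rhaly_well_defined a b theta /\ continuous (rhaly a b theta))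
  <->
  (theta \in in_koethe b /\
   forall k : nat, exists m : nat, exists2 C : R, 0 < C &
     forall n : nat,
       (koethe_seminorm b k (rhaly_seq theta n) <=
        C%:E * koethe_seminorm a m (@unit_seq R s n))%E).
Proof.
split=> [[wd cR]|[thetab bnd]].
  (* [rhaly_seq theta 0] is convertible to [theta], since [0 <= j] computes to true. *)
  by split; [exact: (wd.1 0%N)|exact: rhaly_bounded_of_continuous].
have wd := rhaly_well_defined_of_bounded thetab bnd.
by split=> //; exact: rhaly_continuous_of_bounded.
Qed.
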